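(* Let $\gamma\in\mathbb{R}_{>0}$, and suppose $(P_t)_{t\in\mathbb{N}_0}\subset\mathbb{S}_{++}^n$ satisfies $(\exists\varepsilon\in\mathbb{R}_{>0})(\forall t\in\mathbb{N}_0)\ P_{t+1}-\gamma^2I_n\preceq-\varepsilon I_n$ and $(\forall t\in\mathbb{N}_0)\ P_t=\mathcal{R}_{\gamma,t}(P_{t+1})$, in addition to $\underline\lambda:=\inf_{t\in\mathbb{N}_0}\lambda_{\min}(P_t)>0$. Further, given $\beta\in\mathbb{R}_{>0}$ and $(X_{t+1})_{t\in\mathbb{N}_0}\subset\mathbb{S}_{++}^n$, suppose there exists $\varepsilon\in\mathbb{R}_{>0}$ such that for all $t\in\mathbb{N}_0$, $$P_{t+1}\prec X_{t+1}\quad\text{and}\quad\delta(X_{t+1},P_{t+1})\le\log((\eta-\varepsilon)\underline\lambda+1),$$ where $\eta:=\gamma^{-2}-(\gamma+\beta)^{-2}>0$. Let the control input of the system be given by the state feedback policy $u_t=-K_{\gamma+\beta,t}(X_{t+1})\,x_t$, $t\in\mathbb{N}_0$. Then $J_{\gamma+\beta}(u,w)\le0$ for all $w\in\ell_2$.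
   Context: Notation. $\mathbb{N}_0=\{0\}\cup\mathbb{N}$. $X'$ is the transpose of $X$. $\mathbb{S}^n$, $\mathbb{S}_+^n$, $\mathbb{S}_{++}^n$ are the real symmetric, symmetric positive semidefinite, and symmetric positive definite $n\times n$ matrices. $Y\preceq Z$ means $Z-Y\in\mathbb{S}_+^n$; $Y\prec Z$ means $Z-Y\in\mathbb{S}_{++}^n$. $Z^{1/2}$ is the positive semidefinite square root of $Z\in\mathbb{S}_+^n$. $\ell_2$ is the set of sequences $w=(w_t)_{t\in\mathbb{N}_0}$ with $\|w\|_2^2:=\sum_t w_t'w_t<+\infty$. System. $x_{t+1}=A_tx_t+B_tu_t+w_t$, $t\in\mathbb{N}_0$, $x_0=0\in\mathbb{R}^n$, $u_t\in\mathbb{R}^m$, $w_t\in\mathbb{R}^n$, with performance output $z_t=\begin{bmatrix}Q_t^{1/2}x_t\\ R_t^{1/2}u_t\end{bmatrix}$, where $A_t\in\mathbb{R}^{n\times n}$, $B_t\in\mathbb{R}^{n\times m}$, $Q_t\in\mathbb{S}_+^n$, $R_t\in\mathbb{S}_{++}^m$. For $\alpha>0$, $J_\alpha(u,w):=\|z\|_2^2-\alpha^2\|w\|_2^2=\sum_{t\in\mathbb{N}_0}(z_t'z_t-\alpha^2w_t'w_t)$. Standing assumptions. (i) $A_t,B_t,Q_t,R_t$ and the inverses $A_t^{-1},R_t^{-1}$ are uniformly bounded over $t\in\mathbb{N}_0$ (in particular $A_t$ is non-singular). (ii) With $\Phi_{t,t}:=I_n$ and $\Phi_{s,t}:=A_{s-1}\cdots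 A_t$ for $s>t$, there exist $d\in\mathbb{N}$ and $c>0$ such that for all $t\in\mathbb{N}_0$: $\sum_{s=t}^{t+d-1}\Phi_{s,t}'Q_s\Phi_{s,t}\succeq cI_n$ and $\sum_{s=t}^{t+d-1}\Phi_{t+d,s+1}B_sB_s'\Phi_{t+d,s+1}'\succeq cI_n$. One-step Riccati operator. For $\gamma>0$ and $P\in\mathbb{S}^n$, $\mathcal{R}_{\gamma,t}(P):=Q_t+A_t'PA_t-L_t(P)'(M_{\gamma,t}(P))^{-1}L_t(P)$, where $L_t(P):=\begin{bmatrix}B_t&I_n\end{bmatrix}'PA_t$ and $M_{\gamma,t}(P):=\begin{bmatrix}R_t+B_t'PB_t&B_t'P\\ PB_t&P-\gamma^2I_n\end{bmatrix}$. Feedback gain. For $\alpha>0$ and $X\in\mathbb{S}_{++}^n$ with $X\prec\alpha^2I_n$, $K_{\alpha,t}(X):=(\nabla_{\alpha,t}(X))^{-1}B_t'(X^{-1}-\alpha^{-2}I_n)^{-1}A_t$, with $\nabla_{\alpha,t}(X):=R_t+B_t'(X^{-1}-\alpha^{-2}I_n)^{-1}B_t$. Riemannian distance. For $X,P\in\mathbb{S}_{++}^n$, $\delta(X,P):=\sqrt{\sum_{i=1}^n(\log\lambda_i)^2}$, where $\lambda_1,\dots,\lambda_n>0$ are the eigenvalues of $XP^{-1}$ with multiplicity. *)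

(* Defs.v *)
From HB Require Import structures.
From mathcomp Require Import all_boot all_order all_algebra.
From mathcomp Require Import all_classical all_reals all_analysis.

Set Implicit Arguments.
Unset Strict Implicit.
Unset Printing Implicit Defensive.

Import Order.TTheory GRing.Theory Num.Theory.
Import numFieldNormedType.Exports.

Local Open Scope classical_set_scope.
Local Open Scope ring_scope.

Section SymmetricMatrices.
Variables (R : realType) (n : nat).
Implicit Types (Y Z X P : 'M[R]_n).

Definition psd Z : Prop :=
  Z^T = Z /\ forall v : 'cV[R]_n, 0 <= (v^T *m Z *m v) 0 0.

Definition posdef Z : Prop :=
  Z^T = Z /\ forall v : 'cV[R]_n, v != 0 -> 0 < (v^T *m Z *m v) 0 0.

Definition loewner_le Y Z : Prop := psd (Z - Y).

Definition loewner_lt Y Z : Prop := posdef (Z - Y).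

(* The unique psd square root when Z is psd; a junk value otherwise. *)
Definition psd_sqrt Z : 'M[R]_n := xget 0 [set S | psd S /\ S *m S = Z].

(* For symmetric Z (and n > 0) the set is finite and nonempty, so its infimum
   is the smallest eigenvalue. *)
Definition lambda_min Z : R := inf [set a | eigenvalue Z a].

(* The eigenvalues of Z listed, in some order, with algebraic multiplicity,
   when the characteristic polynomial splits over R, as it does for the product
   of two positive definite matrices; a junk value otherwise. *)
Definition spectrum Z : 'rV[R]_n :=
  xget 0 [set l : 'rV[R]_n | char_poly Z = \prod_(i < n) ('X - (l 0 i)%:P)].

Definition riem_dist X P : R :=
  Num.sqrt (\sum_(i < n) ln (spectrum (X *m invmx P) 0 i) ^+ 2).

End SymmetricMatrices.

Section SquareSummable.
Variables (R : realType) (k : nat).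

(* Extended-real valued: +oo when v is not square-summable. *)
Definition l2_normsq (v : nat -> 'cV[R]_k) : \bar R :=
  (\sum_(0 <= t <oo) (((v t)^T *m v t) 0 0)%:E)%E.

Definition in_l2 (v : nat -> 'cV[R]_k) : Prop := (l2_normsq v < +oo)%E.

End SquareSummable.

Record ltv_system (R : realType) (n m : nat) := LTVSystem {
  sysA : nat -> 'M[R]_n;
  sysB : nat -> 'M[R]_(n, m);
  sysQ : nat -> 'M[R]_n;
  sysR : nat -> 'M[R]_m
}.

Section LTVSystem.
Variables (R : realType) (n m : nat) (S : ltv_system R n m).

Let A := sysA S.
Let B := sysB S.
Let Q := sysQ S.
Let W := sysR S.

Definition cost_weights : Prop :=
  forall t, psd (Q t) /\ posdef (W t).

(* The norm on matrices is the entrywise maximum; at fixed dimensions uniform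
   boundedness does not depend on the choice of norm. *)
Definition uniformly_bounded_data : Prop :=
  [/\ bounded_fun A, bounded_fun B, bounded_fun Q & bounded_fun W] /\
  [/\ forall t, A t \in unitmx,
      bounded_fun (fun t => invmx (A t)),
      forall t, W t \in unitmx &
      bounded_fun (fun t => invmx (W t))].

(* transition_from t k = A_{t+k-1} ... A_t *)
Fixpoint transition_from (t k : nat) : 'M[R]_n :=
  if k is k'.+1 then A (t + k')%N *m transition_from t k' else 1%:M.

(* Phi_{s,t}, only meaningful for t <= s. *)
Definition Phi (s t : nat) : 'M[R]_n := transition_from t (s - t).

Definition uniformly_observable_controllable : Prop :=
  exists (d : nat) (c : R), [/\ (0 < d)%N, 0 < c &
    forall t : nat,
      loewner_le c%:M
        (\sum_(t <= s < t + d) ((Phi s t)^T *m Q s *m Phi s t)) /\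
      loewner_le c%:M
        (\sum_(t <= s < t + d)
           (Phi (t + d) s.+1 *m B s *m (B s)^T *m (Phi (t + d) s.+1)^T))].

Definition riccati_L (t : nat) (P : 'M[R]_n) : 'M[R]_(m + n, n) :=
  (row_mx (B t) 1%:M)^T *m P *m A t.

Definition riccati_M (g : R) (t : nat) (P : 'M[R]_n) : 'M[R]_(m + n) :=
  block_mx (W t + (B t)^T *m P *m B t) ((B t)^T *m P)
           (P *m B t)                  (P - (g ^+ 2)%:M).

Definition riccati (g : R) (t : nat) (P : 'M[R]_n) : 'M[R]_n :=
  Q t + (A t)^T *m P *m A t
  - (riccati_L t P)^T *m invmx (riccati_M g t P) *m riccati_L t P.

Definition gain_nabla (a : R) (t : nat) (X : 'M[R]_n) : 'M[R]_m :=
  W t + (B t)^T *m invmx (invmx X - (a ^- 2)%:M) *m B t.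

Definition gain (a : R) (t : nat) (X : 'M[R]_n) : 'M[R]_(m, n) :=
  invmx (gain_nabla a t X) *m (B t)^T *m invmx (invmx X - (a ^- 2)%:M) *m A t.

Fixpoint state (u : nat -> 'cV[R]_m) (w : nat -> 'cV[R]_n) (t : nat) :
    'cV[R]_n :=
  if t is t'.+1 then A t' *m state u w t' + B t' *m u t' + w t' else 0.

Definition output (u : nat -> 'cV[R]_m) (w : nat -> 'cV[R]_n) (t : nat) :
    'cV[R]_(n + m) :=
  col_mx (psd_sqrt (Q t) *m state u w t) (psd_sqrt (W t) *m u t).

(* The output need not be square-summable, in which case the value is +oo.
   For w in l2 the difference is never of the form oo - oo. *)
Definition J (a : R) (u : nat -> 'cV[R]_m) (w : nat -> 'cV[R]_n) : \bar R :=
  (l2_normsq (output u w) - (a ^+ 2)%:E * l2_normsq w)%E.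

End LTVSystem.

(* Main.v *)
(* The function x' P_t x is a storage function for the closed loop with policy
   u = - K(X) x, at level a = gamma + beta.  The distance bound and P < X give
   P <= X <= mu P with mu = (eta - eps) lam + 1, hence
   P^-1 - X^-1 <= (eta - eps) lam X^-1 <= (eta - eps) I, that is
   X^-1 - a^-2 I >= P^-1 - gamma^-2 I + eps I.  Given the state, maximizing over
   the disturbance leaves the cost u'Ru + h'(X^-1 - a^-2 I)^-1 h with
   h = A x + B u; the gain K(X) minimizes it, and at the saddle point of the game
   defining R_gamma(P) it is at most x'(R_gamma(P) - Q) x.  So each step
   dissipates, and the sum telescopes. *)
Require Import Defs.
From HB Require Import structures.
From mathcomp Require Import all_boot all_order all_algebra.
From mathcomp Require Import all_classical all_reals all_analysis.
From mathcomp Require Import complex ring lra.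

Set Implicit Arguments.
Unset Strict Implicit.
Unset Printing Implicit Defensive.

Import Order.TTheory GRing.Theory Num.Theory.
Import numFieldNormedType.Exports.

Local Open Scope classical_set_scope.
Local Open Scope ring_scope.

(** * Diagonalization and functional calculus of real symmetric matrices *)

Lemma char_poly_similar (F : fieldType) (n : nat) (A B T : 'M[F]_n) :
  T \in unitmx -> T *m A = B *m T -> char_poly A = char_poly B.
Proof.
move=> Tu TA.
have Tdet : \det (map_mx (@polyC F) T) != 0.
  by rewrite det_map_mx polyC_eq0 -unitfE -unitmxE.
apply: (mulfI Tdet); rewrite [RHS]mulrC -!det_mulmx; congr (\det _).
by rewrite /char_poly_mx mulmxBr mulmxBl -!map_mxM TA scalar_mxC.
Qed.

Lemma poly_interpolation (F : fieldType) (s : seq F) (f : F -> F) :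
  exists p : {poly F}, {in s, forall x, p.[x] = f x}.
Proof.
elim: s => [|a s [p ps]]; first by exists 0.
have [/ps pa|a_s] := boolP (a \in s).
  by exists p => x; rewrite inE => /predU1P[->|/ps].
(* [q] vanishes on [s] but not at [a], so a multiple of it corrects the value at [a] and keeps the
   others. *)
pose q := \prod_(y <- s) ('X - y%:P).
have qa : q.[a] != 0 by rewrite -[_ == 0]/(root q a) root_prod_XsubC.
exists (p + ((f a - p.[a]) / q.[a])%:P * q) => x; rewrite inE !hornerE.
have [-> _|_ /= xs] := eqVneq x a; first by rewrite divfK// addrC subrK.
have /eqP -> : root q x by rewrite root_prod_XsubC.
by rewrite mulr0 addr0 ps.
Qed.

Lemma mulmx_conj_diag (F : fieldType) (n : nat) (U : 'M[F]_n) (d e : 'rV[F]_n) :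
  U \in unitmx ->
  invmx U *m diag_mx d *m U *m (invmx U *m diag_mx e *m U)
    = invmx U *m diag_mx (\row_i (d 0 i * e 0 i)) *m U.
Proof.
by move=> Uu; rewrite -mulmx_diag !mulmxA mulmxK.
Qed.

(* The splitting field is kept abstract: unification with the structures of
   [R[i]] is very slow. *)
Lemma symmetric_diagonalization (R : realType) (n : nat) (Z : 'M[R]_n) :
  Z^T = Z ->
  exists (K : fieldType) (iota : {rmorphism R -> K}) (U : 'M[K]_n) (l : 'rV[R]_n),
    U \in unitmx /\ map_mx iota Z = invmx U *m diag_mx (map_mx iota l) *m U.
Proof.
move=> Zs; exists R[i], (real_complex R); pose Zc := map_mx (real_complex R) Z.
have Zherm : Zc \is hermsymmx.
  apply: realsym_hermsym.
    by apply/is_hermitianmxP/matrixP => i j; rewrite !mxE expr0 mul1r -[in LHS]Zs mxE.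
  by apply/mxOverP => i j; rewrite mxE complex_real.
have /orthomx_spectralP ZE := hermitian_normalmx Zherm.
have /mxOverP dr := hermitian_spectral_diag_real Zherm.
exists (spectralmx Zc), (map_mx (@complex.Re R) (spectral_diag Zc)).
split; first exact: spectral_unit.
rewrite -/Zc {1}ZE.
suff -> : map_mx (real_complex R) (map_mx (@complex.Re R) (spectral_diag Zc))
  = spectral_diag Zc by [].
by apply/rowP => i; rewrite !mxE RRe_real.
Qed.

Section Diagonalized.
Variables (F K : fieldType) (iota : {rmorphism F -> K}) (n : nat).
Variables (Z : 'M[F]_n) (U : 'M[K]_n) (l : 'rV[F]_n).
Hypothesis Uu : U \in unitmx.
Hypothesis ZE : map_mx iota Z = invmx U *m diag_mx (map_mx iota l) *m U.

Lemma char_poly_diagonalized : char_poly Z = \prod_(i < n) ('X - (l 0 i)%:P).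
Proof.
apply: (map_poly_inj iota).
rewrite map_char_poly (@char_poly_similar _ _ _ (diag_mx (map_mx iota l)) U)//;
  last by rewrite ZE !mulmxA mulmxV// mul1mx.
rewrite char_poly_trig ?diag_mx_is_trig// rmorph_prod; apply: eq_bigr => i _.
by rewrite !mxE eqxx mulr1n rmorphB /= map_polyX map_polyC.
Qed.

Lemma eigenvalue_diagonalized a : eigenvalue Z a <-> exists i, a = l 0 i.
Proof.
rewrite eigenvalue_root_char char_poly_diagonalized /root horner_prod prodf_seq_eq0.
split=> [/hasP[i _ /=]|[i ->]].
  by rewrite hornerXsubC subr_eq0 => /eqP ->; exists i.
by apply/hasP; exists i; rewrite ?mem_index_enum //= hornerXsubC subrr.
Qed.

(* A polynomial interpolating [f] at the eigenvalues keeps [S] over [F]. *)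
Lemma functional_calculus (f : F -> F) : Z^T = Z ->
  exists2 S : 'M[F]_n, S^T = S &
    map_mx iota S = invmx U *m diag_mx (map_mx iota (map_mx f l)) *m U.
Proof.
case: n Z U l Uu ZE => [|k] Y V d Vu YE Ys.
  by exists 0; [rewrite trmx0|rewrite [RHS]flatmx0 map_mx0].
have [p pf] := @poly_interpolation F [seq d 0 i | i <- enum 'I_k.+1] f.
exists (horner_mx Y p).
  (* The transpose reverses the product of [Y] and a polynomial in [Y]; these commute. *)
  elim/poly_ind: p {pf} => [|q c IH]; first by rewrite rmorph0 trmx0.
  rewrite rmorphD rmorphM /= horner_mx_X horner_mx_C linearD /= tr_scalar_mx.
  by rewrite trmx_mul IH Ys; congr (_ + _); apply: comm_mx_horner.
rewrite map_horner_mx YE (horner_mx_uconjC _ _ Vu) horner_mx_diag.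
congr (_ *m diag_mx _ *m _); apply/rowP => i; rewrite !mxE horner_map /= pf//.
by apply: map_f; rewrite mem_enum.
Qed.

End Diagonalized.

Lemma symmetric_char_poly_split (R : realType) (n : nat) (Z : 'M[R]_n) :
  Z^T = Z -> exists l : 'rV[R]_n, char_poly Z = \prod_(i < n) ('X - (l 0 i)%:P).
Proof.
move=> /symmetric_diagonalization[K [iota [U [l [Uu ZE]]]]].
by exists l; exact: char_poly_diagonalized ZE.
Qed.

(** Nonnegativity is put on eigenvalues rather than on the quadratic form, because
    [symmetric_ge_eigenvalues] derives bounds on the form from this root. *)
Lemma symmetric_sqrt (R : realType) (n : nat) (Z : 'M[R]_n) :
  Z^T = Z -> (forall a, eigenvalue Z a -> 0 <= a) ->
  exists T : 'M[R]_n,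
    [/\ T^T = T, T *m T = Z & forall a, eigenvalue T a -> 0 <= a].
Proof.
move=> Zs Z0; have [K [iota [U [l [Uu ZE]]]]] := symmetric_diagonalization Zs.
have [T Ts TE] := functional_calculus Uu ZE Num.sqrt Zs.
have l0 i : 0 <= l 0 i.
  by apply: Z0; apply/(eigenvalue_diagonalized Uu ZE); exists i.
exists T; split=> //.
  apply: (map_mx_inj (f := iota)); rewrite map_mxM TE ZE mulmx_conj_diag//.
  congr (_ *m diag_mx _ *m _); apply/rowP => i.
  by rewrite !mxE /= -rmorphM /= -expr2 sqr_sqrtr.
move=> a /(eigenvalue_diagonalized Uu TE)[i ->].
by rewrite mxE sqrtr_ge0.
Qed.

(** * The Euclidean inner product *)

Definition dot {R : realType} {k : nat} (u v : 'cV[R]_k) : R := (u^T *m v) 0 0.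

Section Dot.
Variable R : realType.

Lemma dotE k (u v : 'cV[R]_k) : dot u v = \sum_i u i 0 * v i 0.
Proof. by rewrite /dot mxE; apply: eq_bigr => i _; rewrite mxE. Qed.

Lemma dotC k (u v : 'cV[R]_k) : dot u v = dot v u.
Proof. by rewrite !dotE; apply: eq_bigr => i _; rewrite mulrC. Qed.

Lemma dotDl k (u v w : 'cV[R]_k) : dot (u + v) w = dot u w + dot v w.
Proof. by rewrite /dot linearD mulmxDl mxE. Qed.

Lemma dotDr k (u v w : 'cV[R]_k) : dot w (u + v) = dot w u + dot w v.
Proof. by rewrite dotC dotDl !(dotC w). Qed.

Lemma dotZl k c (u v : 'cV[R]_k) : dot (c *: u) v = c * dot u v.
Proof. by rewrite /dot linearZ -scalemxAl mxE. Qed.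

Lemma dotZr k c (u v : 'cV[R]_k) : dot u (c *: v) = c * dot u v.
Proof. by rewrite dotC dotZl dotC. Qed.

Lemma dotNl k (u v : 'cV[R]_k) : dot (- u) v = - dot u v.
Proof. by rewrite -scaleN1r dotZl mulN1r. Qed.

Lemma dotNr k (u v : 'cV[R]_k) : dot u (- v) = - dot u v.
Proof. by rewrite dotC dotNl dotC. Qed.

Lemma dot_mulmxl k l (A : 'M[R]_(k, l)) u v : dot (A *m u) v = dot u (A^T *m v).
Proof. by rewrite /dot trmx_mul mulmxA. Qed.

Lemma dot_ge0 k (u : 'cV[R]_k) : 0 <= dot u u.
Proof. by rewrite dotE; apply: sumr_ge0 => i _; rewrite -expr2 sqr_ge0. Qed.

Lemma dot_gt0 k (u : 'cV[R]_k) : u != 0 -> 0 < dot u u.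
Proof.
rewrite lt0r dot_ge0 andbT dotE psumr_eq0 => [|i _]; last by rewrite -expr2 sqr_ge0.
apply: contraNN => /allP u0; apply/eqP/colP => i; rewrite mxE; apply/eqP.
by have := u0 i (mem_index_enum i); rewrite /= mulf_eq0 orbb.
Qed.

Lemma dot_col_mx k l (u1 v1 : 'cV[R]_k) (u2 v2 : 'cV[R]_l) :
  dot (col_mx u1 u2) (col_mx v1 v2) = dot u1 v1 + dot u2 v2.
Proof. by rewrite /dot tr_col_mx mul_row_col mxE. Qed.

Lemma quadE k (Z : 'M[R]_k) v : (v^T *m Z *m v) 0 0 = dot v (Z *m v).
Proof. by rewrite /dot mulmxA. Qed.

End Dot.

(** * Quadratic forms, inverses, square roots and the Riemannian distance *)

Section Order.
Variables (R : realType) (n : nat).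
Implicit Types (Z M N P X : 'M[R]_n) (v q p : 'cV[R]_n).

Lemma psd_ge0 Z v : psd Z -> 0 <= dot v (Z *m v).
Proof. by case=> _ /(_ v); rewrite quadE. Qed.

Lemma posdef_gt0 Z v : posdef Z -> v != 0 -> 0 < dot v (Z *m v).
Proof. by case=> _ /(_ v); rewrite quadE. Qed.

Lemma posdef_psd Z : posdef Z -> psd Z.
Proof.
move=> [Zs Z0]; split=> // v; have [->|/Z0/ltW//] := eqVneq v 0.
by rewrite mulmx0 mxE.
Qed.

Lemma posdef1 : posdef (1%:M : 'M[R]_n).
Proof.
split=> [|v v0]; first exact: tr_scalar_mx.
by rewrite quadE mul1mx dot_gt0.
Qed.

Lemma unitmx_ker0 Z : (forall v, Z *m v = 0 -> v = 0) -> Z \in unitmx.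
Proof.
move=> Z0; rewrite -unitmx_tr -row_free_unit -kermx_eq0.
apply/rowV0P => v /sub_kermxP vZ; apply: trmx_inj.
by rewrite trmx0; apply: Z0; rewrite -[Z]trmxK -trmx_mul vZ trmx0.
Qed.

Lemma posdef_unit Z : posdef Z -> Z \in unitmx.
Proof.
move=> Zp; apply: unitmx_ker0 => v Zv; apply/eqP/negPn/negP => /(posdef_gt0 Zp).
by rewrite Zv /dot mulmx0 mxE ltxx.
Qed.

Lemma tr_invmx Z : Z^T = Z -> (invmx Z)^T = invmx Z.
Proof. by rewrite trmx_inv => ->. Qed.

(* The convex conjugate of the quadratic form of [N], at [N *m p]. *)
Lemma fenchel_young N p q : psd N ->
  2 * dot q (N *m p) - dot q (N *m q) <= dot p (N *m p).
Proof.
move=> Np; have := psd_ge0 (p - q) Np.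
rewrite mulmxBr !dotDl !dotDr !dotNl !dotNr.
have -> : dot p (N *m q) = dot q (N *m p) by rewrite dotC dot_mulmxl Np.1.
by lra.
Qed.

(** By Fenchel-Young for N, every test vector bounds q'N^-1 q from below. The test vector c^-1 M^-1
    q already gives c^-1 q'M^-1 q; its scale is the best one when N = cM. *)
Lemma invmx_antitone M N (c : R) q : posdef M -> posdef N -> 0 < c ->
  (forall v, dot v (N *m v) <= c * dot v (M *m v)) ->
  dot q (invmx M *m q) <= c * dot q (invmx N *m q).
Proof.
move=> Mp Np c0 NM; pose r := invmx M *m q.
have Mr : M *m r = q by rewrite /r mulKVmx ?posdef_unit.
have := fenchel_young (invmx N *m q) (c^-1 *: r) (posdef_psd Np).
rewrite mulKVmx ?posdef_unit// -scalemxAr !dotZl !dotZr.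
have := NM r; rewrite Mr -/r (dotC q r) (dotC (invmx N *m q) q).
set x := dot r q; set y := dot r _; set z := dot q _ => yx.
rewrite -ler_pdivrMl// => xz; apply: le_trans xz.
rewrite -subr_ge0; have -> : 2 * (c^-1 * x) - c^-1 * (c^-1 * y) - c^-1 * x
  = c^-1 ^+ 2 * (c * x - y) by field; rewrite gt_eqF.
by rewrite mulr_ge0 ?sqr_ge0// subr_ge0.
Qed.

(** Z - cI has nonnegative eigenvalues, hence equals T^2 with T symmetric, and v'T^2 v = |Tv|^2. *)
Lemma symmetric_ge_eigenvalues Z (c : R) v : Z^T = Z ->
  (forall a, eigenvalue Z a -> c <= a) -> c * dot v v <= dot v (Z *m v).
Proof.
move=> Zs Zc; have Ws : (Z - c%:M)^T = Z - c%:M.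
  by rewrite linearB /= Zs tr_scalar_mx.
have [a /eigenvalueP[x xZ x0]|T [Ts TE _]] := symmetric_sqrt Ws.
  rewrite -(lerD2l c) addr0; apply: Zc; apply/eigenvalueP; exists x => //.
  by rewrite -[Z](subrK c%:M) mulmxDr xZ mul_mx_scalar -scalerDl addrC.
have := dot_ge0 (T *m v).
by rewrite dot_mulmxl Ts mulmxA TE mulmxBl mul_scalar_mx dotDr dotNr dotZr subr_ge0.
Qed.

Lemma psd_eigenvalue_ge0 Z a : psd Z -> eigenvalue Z a -> 0 <= a.
Proof.
move=> Zp /eigenvalueP[x xZ x0].
have := psd_ge0 x^T Zp; rewrite -{1}Zp.1 -trmx_mul xZ linearZ /= dotZr.
by rewrite pmulr_lge0// dot_gt0// trmx_eq0.
Qed.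

Lemma psd_sqrtP Z : psd Z -> psd (psd_sqrt Z) /\ psd_sqrt Z *m psd_sqrt Z = Z.
Proof.
move=> Zp; rewrite /psd_sqrt; case: xgetP => [S _ //|].
(* An actual root refutes the default branch of [xget]. *)
have [a|T [Ts TT T0]] := symmetric_sqrt Zp.1; first exact: psd_eigenvalue_ge0.
move=> /(_ T) []; split=> //; split=> // v; rewrite quadE.
by have := symmetric_ge_eigenvalues v Ts T0; rewrite mul0r.
Qed.

Lemma dot_psd_sqrt Z v : psd Z ->
  dot (psd_sqrt Z *m v) (psd_sqrt Z *m v) = dot v (Z *m v).
Proof. by move=> /psd_sqrtP[Sp SS]; rewrite dot_mulmxl Sp.1 mulmxA SS. Qed.

Lemma lambda_min_le P v : psd P -> lambda_min P * dot v v <= dot v (P *m v).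
Proof.
move=> Pp; apply: symmetric_ge_eigenvalues => [|a Pa]; first exact: Pp.1.
apply: ge_inf => //; exists 0 => b; exact: psd_eigenvalue_ge0.
Qed.

Lemma lambda_min_ge0 P : psd P -> 0 <= lambda_min P.
Proof.
move=> Pp; rewrite /lambda_min.
(* For n = 0 there is no eigenvalue, and [inf] of the empty set is 0. *)
have [->|/set0P ne] := eqVneq [set a | eigenvalue P a] set0; first by rewrite inf0.
by apply: lb_le_inf => // a; exact: psd_eigenvalue_ge0.
Qed.

(* [X *m invmx P] is similar to a symmetric matrix through the square root
   of [P]. *)
Lemma riem_dist_le X P (mu : R) v : X^T = X -> posdef P ->
  riem_dist X P <= ln mu -> dot v (X *m v) <= Num.max 1 mu * dot v (P *m v).
Proof.
move=> Xs Pp Xmu; have [Tp TT] := psd_sqrtP (posdef_psd Pp).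
set T := psd_sqrt P in Tp TT.
have Tu : T \in unitmx.
  by have := posdef_unit Pp; rewrite -TT unitmx_mul => /andP[].
pose Z := invmx T *m X *m invmx T.
have Zs : Z^T = Z by rewrite !trmx_mul tr_invmx ?Tp.1// Xs mulmxA.
have ZX : char_poly Z = char_poly (X *m invmx P).
  apply: (char_poly_similar (T := T)) => //; rewrite /Z !mulmxA mulmxV// mul1mx.
  rewrite -[in RHS]mulmxA; congr (_ *m _).
  apply: (can_inj (mulKmx (posdef_unit Pp))).
  by rewrite mulKVmx ?posdef_unit// -[X in X *m invmx T]TT mulmxK.
(* Z being symmetric, the polynomial splits over [R], so [spectrum] is not its junk value. *)
have sE : char_poly (X *m invmx P)
    = \prod_(i < n) ('X - (spectrum (X *m invmx P) 0 i)%:P).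
  have [l lE] := symmetric_char_poly_split Zs.
  by rewrite /spectrum; case: xgetP => [x _ //|/(_ l)[]]; rewrite /= -ZX.
set s := spectrum _ in sE.
(* An eigenvalue above 1 has its logarithm bounded by the distance, hence by [ln mu]; the others are
   covered by the maximum. *)
have s_le i : s 0 i <= Num.max 1 mu.
  rewrite le_max; have [//|s1 /=] := leP (s 0 i) 1.
  have : ln (s 0 i) <= ln mu.
    apply: le_trans Xmu; apply: le_trans (ler_norm _) _.
    rewrite -sqrtr_sqr; apply: ler_wsqrtr.
    by rewrite -/s (bigD1 i)//= lerDl; apply: sumr_ge0 => j _; exact: sqr_ge0.
  (* [ln] is 0 at nonpositive arguments, so mu <= 0 would contradict ln s_i > 0. *)
  have [mu0|mu0] := leP mu 0; last by rewrite ler_ln ?posrE// (lt_trans _ s1).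
  by rewrite (ln0 mu0) => /(lt_le_trans (ln_gt0 s1)); rewrite ltxx.
have NZs : (- Z)^T = - Z by rewrite linearN /= Zs.
have NZ a : eigenvalue (- Z) a -> - Num.max 1 mu <= a.
  move=> /eigenvalueP[x xZ x0]; rewrite lerNl.
  have : eigenvalue Z (- a).
    by apply/eigenvalueP; exists x => //; rewrite scaleNr -xZ mulmxN opprK.
  rewrite eigenvalue_root_char ZX sE /root horner_prod prodf_seq_eq0.
  by move=> /hasP[i _ /=]; rewrite hornerXsubC subr_eq0 => /eqP ->.
(* At Tv, the forms of Z and of the identity are those of X and P at v. *)
have := symmetric_ge_eigenvalues (T *m v) NZs NZ.
rewrite !dot_mulmxl Tp.1 (mulmxA T T) TT mulNmx mulmxN dotNr mulNr lerN2.
by rewrite /Z !mulmxA mulmxV// mul1mx mulmxKV.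
Qed.
End Order.

(** * One step of the Riccati game and of the closed loop *)

Section OneStep.
Variables (R : realType) (n m : nat) (sys : ltv_system R n m) (t : nat).
Let A := sysA sys t.
Let B := sysB sys t.
Let Q := sysQ sys t.
Let W := sysR sys t.
Implicit Types (P X : 'M[R]_n) (x w h : 'cV[R]_n) (u : 'cV[R]_m).

(** For (u, w) in the kernel, pair the first block row with u, the second with w, and subtract: the
    cross terms cancel, leaving u'Wu + (Bu)'P(Bu) + w'(g^2 I - P)w = 0, a sum of nonnegative
    terms. *)
Lemma riccati_M_unit (g : R) P : posdef W -> psd P ->
  posdef ((g ^+ 2)%:M - P) -> riccati_M sys g t P \in unitmx.
Proof.
move=> Wp Pp gP; apply: unitmx_ker0 => v; rewrite -[v]vsubmxK.
move: (usubmx v) (dsubmx v) => u w {v}.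
rewrite /riccati_M mul_block_col -/B -/W -[in X in X -> _]col_mx0.
move=> /eq_col_mx[/(congr1 (dot u)) Eu /(congr1 (dot w)) Ew].
have dot0 k (v : 'cV[R]_k) : dot v 0 = 0 by rewrite /dot mulmx0 mxE.
move: Eu; rewrite dot0 !mulmxDl -!mulmxA !dotDr -!(dot_mulmxl B) => Eu.
move: Ew; rewrite dot0 !mulmxDl -!mulmxA !dotDr mulNmx mul_scalar_mx dotNr dotZr.
have -> : dot w (P *m (B *m u)) = dot (B *m u) (P *m w).
  by rewrite dotC dot_mulmxl Pp.1.
move=> Ew; have PB := psd_ge0 (B *m u) Pp.
have uW := psd_ge0 u (posdef_psd Wp); have wg := psd_ge0 w (posdef_psd gP).
have E w' : dot w' (((g ^+ 2)%:M - P) *m w') = g ^+ 2 * dot w' w' - dot w' (P *m w').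
  by rewrite mulmxBl mul_scalar_mx dotDr dotNr dotZr.
have u0 : u = 0.
  by apply/eqP/negPn/negP => /(posdef_gt0 Wp); move: wg; rewrite E; lra.
have w0 : w = 0.
  by apply/eqP/negPn/negP => /(posdef_gt0 gP); move: uW; rewrite E; lra.
by rewrite u0 w0 col_mx0.
Qed.

(* The stationary point of the game with state cost [Q], control [u] and
   disturbance [p / g ^+ 2] has the value [riccati g P]. *)
Lemma riccati_saddle (g : R) P x : g != 0 -> posdef W -> posdef P ->
  posdef ((g ^+ 2)%:M - P) ->
  exists u p,
    A *m x + B *m u = invmx P *m p - g ^- 2 *: p /\
    dot x (riccati sys g t P *m x)
      = dot x (Q *m x) + dot u (W *m u) + dot p (A *m x + B *m u).
Proof.
move=> g0 Wp Pp gP; have Mu := riccati_M_unit Wp (posdef_psd Pp) gP.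
pose v := - (invmx (riccati_M sys g t P) *m (riccati_L sys t P *m x)).
have LxE : riccati_L sys t P *m x
    = col_mx (B^T *m (P *m (A *m x))) (P *m (A *m x)).
  by rewrite /riccati_L tr_row_mx trmx1 !mul_col_mx mul1mx -!mulmxA.
have : riccati_M sys g t P *m v = - (riccati_L sys t P *m x).
  by rewrite /v mulmxN mulKVmx.
have vE : v = col_mx (usubmx v) (dsubmx v) by rewrite vsubmxK.
set u := usubmx v in vE; set w := dsubmx v in vE.
rewrite LxE [in X in X -> _]vE /riccati_M mul_block_col -/B -/W opp_col_mx.
move=> /eq_col_mx[Eu Ew].
(* [p] is half the gradient of the form of P at the next state. In terms of it the block rows of the
   stationarity equation read p = g^2 w and Wu = -B'p. *)
pose p := P *m (A *m x + B *m u + w).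
have pE : p = (g ^+ 2) *: w.
  move: Ew; rewrite /p mulmxDl mulNmx mul_scalar_mx -!mulmxA !mulmxDr.
  move: (P *m (A *m x)) (P *m (B *m u)) (P *m w) (_ *: w) => c1 c2 c3 c4 Ew.
  by apply/colP => i; move/colP/(_ i): Ew; rewrite !mxE; lra.
have Wu : W *m u = - (B^T *m p).
  move: Eu; rewrite /p mulmxDl -!mulmxA !mulmxDr.
  move: (W *m u) (B^T *m _) (B^T *m _) (B^T *m _) => c1 c2 c3 c4 Eu.
  by apply/colP => i; move/colP/(_ i): Eu; rewrite !mxE; lra.
exists u, p; split.
  rewrite {1}/p mulKmx ?posdef_unit// pE scalerA mulVf ?sqrf_eq0 ?expf_neq0//.
  by rewrite scale1r addrK.
(* By Wu = -B'p, both sides reduce to x'Qx + (Ax)'p. *)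
have -> : dot x (Q *m x) + dot u (W *m u) + dot p (A *m x + B *m u)
    = dot x (Q *m x) + dot (A *m x) p.
  rewrite Wu dotNr -dot_mulmxl (dotC p) dotDl; ring.
have -> : riccati sys g t P *m x = Q *m x + A^T *m (P *m (A *m x))
    + (riccati_L sys t P)^T *m v.
  by rewrite /riccati /v mulmxN mulmxBl mulmxDl -!mulmxA.
rewrite !dotDr -!dot_mulmxl LxE [X in dot (col_mx _ _) X]vE dot_col_mx (dot_mulmxl B^T) trmxK.
by rewrite /p !mulmxDr !dotDr !(dot_mulmxl P) Pp.1 !addrA.
Qed.

(** Fenchel-Young for E = X^-1 - a^-2 I, tested at p = X(h + w), bounds the right side from below by
    the left side plus |a^-1 p - a w|^2. *)
Lemma max_disturbance (a : R) X h w : 0 < a -> posdef X ->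
  posdef (invmx X - (a ^- 2)%:M) ->
  dot (h + w) (X *m (h + w)) - a ^+ 2 * dot w w
    <= dot h (invmx (invmx X - (a ^- 2)%:M) *m h).
Proof.
move=> a0 Xp Ep; set E := invmx X - _ in Ep *.
pose p := X *m (h + w).
have Eh : E *m (invmx E *m h) = h by rewrite mulKVmx ?posdef_unit.
have := fenchel_young (invmx E *m h) p (posdef_psd Ep).
rewrite Eh /E mulmxBl mul_scalar_mx mulKmx ?posdef_unit// -/E.
rewrite !(dotDr, dotNr, dotZr) (dotC (invmx E *m h)) (dotC (h + w)) -/p dotDr.
have := dot_ge0 (a^-1 *: p - a *: w).
have -> : dot (a^-1 *: p - a *: w) (a^-1 *: p - a *: w)
    = a ^- 2 * dot p p - 2 * dot p w + a ^+ 2 * dot w w.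
  rewrite !(dotDl, dotNl, dotZl, dotDr, dotNr, dotZr) (dotC w p).
  by field; rewrite gt_eqF.
by lra.
Qed.

(** The cost is a convex quadratic in the control and the equation on [u] is its stationarity.
    Expanding around [u] kills the linear part and leaves d'Wd + (Bd)'Y(Bd) >= 0. *)
Lemma gain_optimal (Y : 'M[R]_n) x u u1 : psd Y -> posdef W ->
  (W + B^T *m Y *m B) *m u = - (B^T *m Y *m A *m x) ->
  dot u (W *m u) + dot (A *m x + B *m u) (Y *m (A *m x + B *m u))
    <= dot u1 (W *m u1) + dot (A *m x + B *m u1) (Y *m (A *m x + B *m u1)).
Proof.
move=> Yp Wp uE; set h := A *m x + B *m u.
have [d u1E] : exists d, u1 = u + d by exists (u1 - u); rewrite addrC subrK.
have -> : A *m x + B *m u1 = h + B *m d by rewrite u1E mulmxDr addrA.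
have dW := psd_ge0 d (posdef_psd Wp); have dY := psd_ge0 (B *m d) Yp.
have stat : dot d (W *m u) + dot (B *m d) (Y *m h) = 0.
  rewrite dot_mulmxl -dotDr.
  have -> : W *m u + B^T *m (Y *m h) = 0; last by rewrite /dot mulmx0 mxE.
  move/eqP: uE; rewrite -addr_eq0 => /eqP <-.
  by rewrite /h !mulmxDr mulmxDl !mulmxA addrAC -!addrA.
rewrite u1E; move: h stat => h stat; rewrite !mulmxDr !(dotDl, dotDr).
have -> : dot u (W *m d) = dot d (W *m u) by rewrite dotC dot_mulmxl Wp.1.
have -> : dot h (Y *m (B *m d)) = dot (B *m d) (Y *m h).
  by rewrite dotC dot_mulmxl Yp.1.
by lra.
Qed.

Lemma closed_loop_step (g a : R) P X x u w : g != 0 -> 0 < a ->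
  posdef W -> posdef P -> posdef X -> posdef ((g ^+ 2)%:M - P) ->
  psd (invmx P - (g ^- 2)%:M) -> posdef (invmx X - (a ^- 2)%:M) ->
  (forall q, dot q (invmx P *m q) - g ^- 2 * dot q q
    <= dot q (invmx X *m q) - a ^- 2 * dot q q) ->
  u = - (gain sys a t X *m x) ->
  forall y, y = A *m x + B *m u + w ->
  dot x (Q *m x) + dot u (W *m u) - a ^+ 2 * dot w w + dot y (X *m y)
    <= dot x (riccati sys g t P *m x).
Proof.
move=> g0 a0 Wp Pp Xp gP Fp Ep FE uE y yE.
have [u1 [p [hE ->]]] := riccati_saddle x g0 Wp Pp gP.
have := max_disturbance (A *m x + B *m u) w a0 Xp Ep.
pose E := invmx X - (a ^- 2)%:M; pose Y := invmx E; rewrite -/E -/Y -yE.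
have Yp : psd Y.
  split=> [|v]; first exact: tr_invmx Ep.1.
  (* Since v = E(Yv), the form of Y at v is that of E at Yv. *)
  rewrite quadE -[v in dot v _](mulKVmx (posdef_unit Ep)) -/E -/Y dotC.
  exact/psd_ge0/posdef_psd.
have nablaE : gain_nabla sys a t X = W + B^T *m Y *m B by [].
have nabla_u : gain_nabla sys a t X \in unitmx.
  apply: posdef_unit; rewrite nablaE; split.
    by rewrite linearD /= !trmx_mul trmxK Wp.1 Yp.1 mulmxA.
  move=> v v0; rewrite quadE mulmxDl dotDr ltr_pwDl ?posdef_gt0//.
  by rewrite -!mulmxA -dot_mulmxl psd_ge0.
have stat : (W + B^T *m Y *m B) *m u = - (B^T *m Y *m A *m x).
  by rewrite uE mulmxN -nablaE /gain !mulmxA mulmxV// mul1mx.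
have := gain_optimal u1 Yp Wp stat.
(* Put F = P^-1 - g^-2 I, so that h1 = Fp, and k = Y h1. Fenchel-Young gives 2 h1'k - k'Fk <= p'h1,
   and k'Fk <= k'Ek = h1'k; hence h1'Y h1 <= p'h1, the last term of the saddle value. *)
set h1 := A *m x + B *m u1 in hE *; move: h1 hE => h1 hE; pose k := Y *m h1.
have := FE k.
have := fenchel_young p k Fp.
rewrite !mulmxBl !mul_scalar_mx -hE !(dotDr, dotNr, dotZr).
have : dot h1 k = dot k (invmx X *m k) - a ^- 2 * dot k k.
  rewrite -dotZr -dotNr -dotDr -mul_scalar_mx -mulmxBl -/E.
  by rewrite mulKVmx ?posdef_unit// dotC.
rewrite -/k (dotC k h1).
by lra.
Qed.

End OneStep.

(** * The gap between inverses, the summation over time, and the theorem *)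

Lemma riem_dist_invmx_gap (R : realType) (n : nat) (P X : 'M[R]_n) (lam e : R)
    (q : 'cV[R]_n) :
  (0 < n)%N -> posdef P -> posdef X -> loewner_lt P X -> 0 < lam ->
  (forall v : 'cV[R]_n, lam * dot v v <= dot v (P *m v)) ->
  riem_dist X P <= ln (e * lam + 1) ->
  dot q (invmx P *m q) - dot q (invmx X *m q) <= e * dot q q.
Proof.
move=> n0 Pp Xp PX lam0 Plam XP; set mu := e * lam + 1 in XP.
have PXv v : dot v (P *m v) <= dot v (X *m v).
  have := psd_ge0 v (posdef_psd PX).
  by rewrite mulmxBl dotDr dotNr subr_ge0.
(* Otherwise [riem_dist_le] gives X <= P, against P < X at a nonzero vector, which exists as n >
   0. *)
have mu1 : 1 < mu.
  rewrite ltNge; apply/negP => mu1; pose v : 'cV[R]_n := const_mx 1.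
  have v0 : v != 0.
    apply/eqP => /colP/(_ (Ordinal n0)); rewrite !mxE => /eqP.
    by rewrite oner_eq0.
  have := posdef_gt0 PX v0; rewrite mulmxBl dotDr dotNr.
  have := riem_dist_le v Xp.1 Pp XP; rewrite max_l// mul1r; lra.
have e0 : 0 < e by move: mu1; rewrite /mu ltrDr pmulr_lgt0.
have mu_gt0 : 0 < mu by apply: lt_trans mu1.
have XmuP v : dot v (X *m v) <= mu * dot v (P *m v).
  by have := riem_dist_le v Xp.1 Pp XP; rewrite max_r// ltW.
have a_le := invmx_antitone q Pp Xp mu_gt0 XmuP.
have b_le : dot q (invmx X *m q) <= 1 * dot q (invmx P *m q).
  by apply: invmx_antitone => // v; rewrite mul1r.
have a_lam : dot q (invmx P *m q) <= lam^-1 * dot q q.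
  have := invmx_antitone (c := lam^-1) q Pp (posdef1 R n).
  rewrite invmx1 mul1mx; apply; first by rewrite invr_gt0.
  by move=> v; rewrite mul1mx ler_pdivlMl.
rewrite mul1r in b_le; rewrite ler_pdivlMl// in a_lam.
(* P^-1 - X^-1 <= (mu - 1) X^-1 = e lam X^-1, and lam X^-1 <= lam P^-1 <= I. *)
have : e * (lam * dot q (invmx X *m q)) <= e * dot q q.
  by rewrite ler_pM2l//; apply: le_trans a_lam; rewrite ler_pM2l.
by apply: le_trans; move: a_le; rewrite /mu; lra.
Qed.

(** The dissipation inequality telescopes over finite horizons. Dropping the nonnegative final
    storage bounds each partial sum of the output energy by a^2 times that of [w], hence by the full
    series. *)
Lemma l2_gain_le0 (R : realType) (n m : nat) (sys : ltv_system R n m) (a : R)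
    (V : nat -> 'cV[R]_n -> R) u w :
  V 0 0 = 0 -> (forall t x, 0 <= V t x) ->
  (forall t, dot (output sys u w t) (output sys u w t) - a ^+ 2 * dot (w t) (w t)
     + V t.+1 (state sys u w t.+1) <= V t (state sys u w t)) ->
  (J sys a u w <= 0)%E.
Proof.
move=> V00 V_ge0 dissip.
have partial T : \sum_(0 <= t < T) dot (output sys u w t) (output sys u w t)
    + V T (state sys u w T) <= a ^+ 2 * \sum_(0 <= t < T) dot (w t) (w t).
  elim: T => [|T IH]; first by rewrite !big_geq// mulr0 add0r V00.
  by rewrite !big_nat_recr//= mulrDr; move: IH (dissip T); lra.
rewrite /J sube_le0.
apply: lime_le; first by apply: is_cvg_nneseries => t _ _; rewrite lee_fin dot_ge0.
apply: nearW => T; rewrite sumEFin.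
apply: (@le_trans _ _ ((a ^+ 2)%:E * (\sum_(0 <= t < T) dot (w t) (w t))%:E)%E).
  by rewrite -EFinM lee_fin; apply: le_trans (partial T); rewrite lerDl.
rewrite lee_wpmul2l ?lee_fin ?sqr_ge0// -sumEFin.
by apply: nneseries_lim_ge => t _ _; rewrite lee_fin dot_ge0.
Qed.

Unset Implicit Arguments.

Theorem theorem4 (R : realType) (n m : nat) (sys : ltv_system R n m)
    (n_gt0 : (0 < n)%N) (m_gt0 : (0 < m)%N)
    (weights : cost_weights sys)
    (bounded_data : uniformly_bounded_data sys)
    (obs_ctrl : uniformly_observable_controllable sys)
    (gamma : R) (gamma_gt0 : 0 < gamma)
    (P : nat -> 'M[R]_n) (P_posdef : forall t, posdef (P t))
    (P_gap : exists2 eps : R, 0 < eps &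
       forall t, loewner_le (P t.+1 - (gamma ^+ 2)%:M) ((- eps)%:M))
    (P_riccati : forall t, P t = riccati sys gamma t (P t.+1))
    (lam : R) (lam_def : lam = inf [set lambda_min (P t) | t in [set: nat]])
    (lam_gt0 : 0 < lam)
    (beta : R) (beta_gt0 : 0 < beta)
    (eta : R) (eta_def : eta = gamma ^- 2 - (gamma + beta) ^- 2)
    (X : nat -> 'M[R]_n) (X_posdef : forall t, posdef (X t.+1))
    (X_close : exists2 eps : R, 0 < eps &
       forall t, loewner_lt (P t.+1) (X t.+1) /\
         riem_dist (X t.+1) (P t.+1) <= ln ((eta - eps) * lam + 1)) :
  forall (w : nat -> 'cV[R]_n) (u : nat -> 'cV[R]_m),
    in_l2 w ->
    (forall t, u t = - (gain sys (gamma + beta) t (X t.+1) *m state sys u w t)) ->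
    (J sys (gamma + beta) u w <= 0)%E.
Proof.
move=> w u _ uE; set a := gamma + beta in eta_def uE *.
have a_gt0 : 0 < a by rewrite addr_gt0.
have P_psd t := posdef_psd (P_posdef t).
have P_lam t v : lam * dot v v <= dot v (P t *m v).
  apply: le_trans (lambda_min_le v (P_psd t)).
  apply: ler_wpM2r; first exact: dot_ge0.
  rewrite lam_def; apply: ge_inf; last by exists t.
  by exists 0 => _ [s _ <-]; exact: lambda_min_ge0.
have [eps1 eps1_gt0 P_eps1] := P_gap.
have P_gamma t : posdef ((gamma ^+ 2)%:M - P t.+1).
  split=> [|v v0]; first by rewrite linearB /= tr_scalar_mx (P_psd _).1.
  rewrite quadE; have := psd_ge0 v (P_eps1 t).
  rewrite !mulmxBl !mul_scalar_mx !(dotDr, dotNr, dotZr).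
  have : 0 < eps1 * dot v v by rewrite mulr_gt0 ?dot_gt0.
  by lra.
have invP_gamma t q : gamma ^- 2 * dot q q <= dot q (invmx (P t.+1) *m q).
  have := invmx_antitone (c := gamma ^+ 2) q (posdef1 R n) (P_posdef t.+1).
  rewrite invmx1 mul1mx => PI; rewrite ler_pdivrMl ?exprn_gt0//; apply: PI.
    by rewrite exprn_gt0.
  move=> v; rewrite mul1mx; have := psd_ge0 v (posdef_psd (P_gamma t)).
  by rewrite mulmxBl mul_scalar_mx dotDr dotNr dotZr subr_ge0.
have [eps eps_gt0 X_eps] := X_close.
(* This is [riem_dist_invmx_gap] at e = eta - eps: the two terms of eta are the shifts at levels
   gamma and a, and eps remains as a margin. *)
have XP_gap t q : dot q (invmx (P t.+1) *m q) - gamma ^- 2 * dot q q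
    + eps * dot q q <= dot q (invmx (X t.+1) *m q) - a ^- 2 * dot q q.
  have [PX XP] := X_eps t.
  have := riem_dist_invmx_gap q n_gt0 (P_posdef _) (X_posdef t) PX lam_gt0
    (P_lam t.+1) XP.
  by rewrite eta_def !mulrDl !mulNr; lra.
apply: (l2_gain_le0 (V := fun t x => dot x (P t *m x))).
- by rewrite mulmx0 /dot mulmx0 mxE.
- by move=> t x; exact: psd_ge0.
move=> t; have [Q_psd W_posdef] := weights t.
set x := state sys u w t.
have step := @closed_loop_step R n m sys t gamma a (P t.+1) (X t.+1) x (u t) (w t)
  (lt0r_neq0 gamma_gt0) a_gt0 W_posdef (P_posdef _) (X_posdef _) (P_gamma _) _ _ _
  (uE t) (state sys u w t.+1) erefl.
rewrite /output dot_col_mx !dot_psd_sqrt//; last exact: posdef_psd.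
rewrite -/x [P t]P_riccati; apply: le_trans (step _ _ _).
(* [step] controls the form of X at the next state; the storage is the form of P, which is smaller
   by P < X. *)
- rewrite lerD2l; have := psd_ge0 (state sys u w t.+1) (posdef_psd (X_eps t).1).
  by rewrite mulmxBl dotDr dotNr subr_ge0.
- split=> [|v].
    by rewrite linearB /= tr_scalar_mx tr_invmx// (P_psd _).1.
  by rewrite quadE mulmxBl mul_scalar_mx dotDr dotNr dotZr subr_ge0.
(* Strictness comes from the margin eps, as P^-1 - gamma^-2 I enters only as semidefinite. *)
- split=> [|v v0].
    by rewrite linearB /= tr_scalar_mx tr_invmx// (X_posdef _).1.
  rewrite quadE mulmxBl mul_scalar_mx dotDr dotNr dotZr.
  have : 0 < eps * dot v v by rewrite mulr_gt0 ?dot_gt0.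
  by move: (XP_gap t v) (invP_gamma t v); lra.
- move=> q; apply: le_trans (XP_gap t q).
  by rewrite lerDl mulr_ge0 ?dot_ge0// ltW.
Qed.
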